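(* Let $n\ge 2k$ and let $\mathcal F\subset\binom{[n]}{k}$ be a nonempty intersecting family with $|\mathcal F|\ge 48\binom{n-3}{k-3}$. Then $\varrho(\mathcal F)>\frac12$.
   Context: A family $\mathcal F$ is intersecting if $F\cap F'\neq\emptyset$ for all $F,F'\in\mathcal F$. For $i\in[n]$, $\mathcal F(i)=\{F\setminus\{i\}: i\in F\in\mathcal F\}$, and $\varrho(\mathcal F)=\max_{i\in[n]}|\mathcal F(i)|/|\mathcal F|$. *)

(* Defs.v *)
From mathcomp Require Import all_boot all_order all_algebra.
Set Implicit Arguments. Unset Strict Implicit. Unset Printing Implicit Defensive.
Import Order.TTheory GRing.Theory Num.Theory.

Definition intersecting (n : nat) (F : {set {set 'I_n}}) : Prop :=
  forall A B, A \in F -> B \in F -> A :&: B != set0.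

Definition uniform (n k : nat) (F : {set {set 'I_n}}) : Prop :=
  forall A, A \in F -> #|A| = k.

(* |F(i)| : number of members of F containing i (F(i) = {F \ {i} : i in F in F}
   is in bijection with these). *)
Definition degree (n : nat) (F : {set {set 'I_n}}) (i : 'I_n) : nat :=
  #|[set A in F | i \in A]|.

Definition rho (n : nat) (F : {set {set 'I_n}}) : rat :=
  ((\max_(i < n) degree F i)%:R / #|F|%:R)%R.

(* Binomial coefficient binom(a, b) with integer lower index b = k - 3,
   which is 0 when k < 3 (avoids truncated subtraction). *)
Definition binom_n3_k3 (n k : nat) : nat :=
  if 3 <= k then 'C(n - 3, k - 3) else 0.

(* Main.v *)
Require Import Defs.
From mathcomp Require Import all_boot all_order all_algebra.
From mathcomp Require Import zify.
Import Order.TTheory GRing.Theory Num.Theory.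
Set Implicit Arguments. Unset Strict Implicit. Unset Printing Implicit Defensive.

(** Suppose every degree is at most |F|/2, and write c for C(n-3, k-3).
    Apply shifts j -> i (i < j) to F as long as this bound survives; a pair
    {i, j} whose shift would break it is met by more than |F|/2 members.

    Let F be shift-stable off a small set W.  Reading a member along the
    complement of W as a lattice path, two members that are disjoint on W must
    have paths whose heights add up to at least 2 somewhere, and the reflection
    principle counts the members whose path reaches a given height.  Call a pair
    e deep if some member meets W inside e, contains e, and has a path that stays
    strictly below 0 off e: then at most 2c members avoid e.  If e is not deep,
    only O(c) members have trace e, and explicit constants give the rest.

    If at most two disjoint pairs resist shifting, W can be taken of size at
    most 4; then 48c members force a deep pair {x, y}, and the bound on the
    degrees forces a triangle x, y, z of deep pairs.  Nearly every member
    contains two of x, y, z, so some degree is about 2|F|/3, a contradiction.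
    If three disjoint pairs P, Q, R resist, shift freely off two of them (this
    keeps all traces on them): the deep pairs form a star centred off P and Q, so
    at most 8c members meet both P and Q.  Summing over the three choices,
    3|F| < 2(|F| + 24c), which contradicts |F| >= 48c. *)

(** * Lattice paths *)

(** [j] is the climb still missing: a letter in [A] is an up step, any other a down step. The test
    succeeds once the missing climb is 0, even if the path falls later. *)
Fixpoint ballot (T : finType) (s : seq T) (j : nat) (A : {set T}) : bool :=
  (j == 0) ||
  if s is x :: s' then ballot s' (if x \in A then j.-1 else j.+1) A else false.

Lemma ballot0 (T : finType) (s : seq T) (A : {set T}) : ballot s 0 A.
Proof. by case: s. Qed.

Lemma eq_in_ballot (T : finType) (s : seq T) j (A B : {set T}) :
  {in s, A =i B} -> ballot s j A = ballot s j B.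
Proof.
elim: s j => [|x s IHs] j //= eqAB; rewrite (eqAB x (mem_head _ _)).
by rewrite IHs // => y ys; rewrite eqAB // inE ys orbT.
Qed.

Lemma ballot_catl (T : finType) (s r : seq T) j (A : {set T}) :
  ballot s j A -> ballot (s ++ r) j A.
Proof.
elim: s j => [|x s IHs] j /=; first by rewrite orbF => /eqP->; apply: ballot0.
by case/orP=> [->//|/IHs->]; rewrite orbT.
Qed.

Lemma ballot_leq_count (T : finType) (s : seq T) j (A : {set T}) :
  ballot s j A -> j <= count (mem A) s.
Proof.
elim: s j => [|x s IHs] j /=; first by rewrite orbF => /eqP->.
by case/orP=> [/eqP->//|/IHs]; case: (x \in A) => /=; lia.
Qed.

(** Discrete intermediate values: a path with unit steps that is at height at least [j] after [i]
    letters has passed through [j]. *)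
Lemma take_ballot (T : finType) (s : seq T) i j (A : {set T}) :
  i <= size s -> i + j <= 2 * count (mem A) (take i s) -> ballot s j A.
Proof.
elim: s i j => [|x s IHs] i j /=; first by case: i j => [|i] [|j].
case: i => [|i] le_i; first by case: j.
rewrite /= => le_c; case: j le_c => [|j] //= le_c; apply: (IHs i) => //.
by move: le_c; case: (x \in A) => /=; lia.
Qed.

Lemma card_subset_count (T : finType) (s : seq T) (A : {set T}) :
  uniq s -> A \subset [set y in s] -> #|A| = count (mem A) s.
Proof.
move=> us /subsetP sAs; rewrite -size_filter -(elimT card_uniqP (filter_uniq _ us)).
apply: eq_card => y; rewrite mem_filter /=; case: (boolP (y \in A)) => //= yA.
by have := sAs _ yA; rewrite inE => ->.
Qed.

(* The reflection principle, read as Pascal's rule: removing the first letter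
   turns j into j - 1 or j + 1. *)
Lemma card_ballot (T : finType) (s : seq T) (m j : nat) : uniq s ->
  #|[set A : {set T} | [&& A \subset [set y in s], #|A| == m + j & ballot s j A]]|
     <= 'C(size s, m).
Proof.
elim: s m j => [|x s IHs] m j.
  move=> _; rewrite (leq_trans (n := (m == 0))) //; last by case: m.
  have sA0 (A : {set T}) : A \subset [set y in [::]] -> A = set0.
    by move=> sA; apply/eqP; rewrite -subset0; apply: subset_trans sA _; apply/subsetP=> y; rewrite !inE.
  case: m => [|m]; last first.
    rewrite leqn0 cards_eq0 -subset0; apply/subsetP => A; rewrite !inE.
    by case/and3P=> /sA0->; rewrite cards0.
  rewrite eqxx -[nat_of_bool true]/1 -(cards1 (set0 : {set T})); apply/subset_leq_card/subsetP => A.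
  by rewrite !inE => /and3P[/sA0->].
move=> /= /andP[xs us]; case: j => [|j].
  have cxs : #|[set y in x :: s]| = (size s).+1.
    by rewrite cardsE; apply/(@card_uniqP _ (x :: s)); rewrite /= xs.
  rewrite addn0 -cxs -cards_draws; apply/subset_leq_card/subsetP => A; rewrite !inE.
  by case/and3P=> -> ->.
set E := [set A : {set T} | _]; rewrite -(cardsID [set A : {set T} | x \in A] E).
have sub_s (A : {set T}) : A \subset [set y in x :: s] -> x \notin A -> A \subset [set y in s].
  move=> /subsetP sA xA; apply/subsetP=> y yA; have := sA y yA; rewrite !inE.
  by case/orP=> // /eqP yx; move: xA; rewrite -yx yA.
have ->: 'C((size s).+1, m) = 'C(size s, m) + (if m is m'.+1 then 'C(size s, m') else 0).
  by case: m {E} => [|m]; rewrite ?bin0 // binS.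
apply: leq_add.
  rewrite -(card_in_imset (f := fun A => A :\ x)); last first.
    by move=> A B; rewrite !inE => /andP[_ xA] /andP[_ xB] eqAB; rewrite -(setD1K xA) eqAB setD1K.
  apply: leq_trans (IHs m j us); apply/subset_leq_card/subsetP=> _ /imsetP[A AE ->].
  move: AE; rewrite !inE => /andP[/and3P[sA cA bA] xA]; apply/and3P; split.
  - apply: sub_s; last by rewrite setD11.
    by apply: subset_trans (subsetDl _ _) sA.
  - by move: cA; rewrite (cardsD1 x) xA; lia.
  - move: bA; rewrite /= xA; rewrite (@eq_in_ballot _ _ _ _ A) // => y ys.
    by rewrite !inE; case: eqP => // yx; rewrite yx (negbTE xs) in ys.
have step A : A \in E :\: [set A : {set T} | x \in A] ->
  [/\ A \subset [set y in s], #|A| = m + j.+1 & ballot s j.+2 A].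
  rewrite !inE => /andP[xA /and3P[sA /eqP cA]]; rewrite /= (negbTE xA) => bA.
  by split=> //; apply: sub_s.
(* A set without [x] must climb [j.+2] with [m + j.+1] points, so [m] drops by one; for [m = 0] the
   points are too few. *)
case: m E step => [|m] E step.
  rewrite leqn0 cards_eq0 -subset0; apply/subsetP => A /step[sA cA bA].
  by have := ballot_leq_count bA; rewrite -card_subset_count // cA; lia.
apply: leq_trans (IHs m j.+2 us); apply/subset_leq_card/subsetP=> A /step[sA cA bA].
by rewrite inE sA bA cA andbT; apply/eqP; lia.
Qed.

(** * Lattice paths of subsets of an ordered ground set *)

Definition pre (n : nat) (D : {set 'I_n}) (l : nat) : {set 'I_n} := [set x in D | x < l].

(* After the prefix P = pre D l, the lattice path of A along D has height
   2 #|A :&: P| - #|P|; reach and low compare this height with j. *)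
Definition reach (n : nat) (D : {set 'I_n}) (j : nat) (A : {set 'I_n}) : bool :=
  [exists l : 'I_n.+1, #|pre D l| + j <= 2 * #|A :&: pre D l|].

Lemma reachI n (D A : {set 'I_n}) j l :
  #|pre D l| + j <= 2 * #|A :&: pre D l| -> reach D j A.
Proof.
move=> h; apply/existsP; case: (leqP l n) => [le_ln|lt_nl].
  by exists (Ordinal (le_ln : l < n.+1)).
exists ord_max; rewrite (_ : pre D _ = pre D l) //; apply/setP=> x.
by rewrite !inE /= ltn_ord (ltn_trans (ltn_ord x) lt_nl).
Qed.

Lemma filter_ltn_sorted n (s : seq 'I_n) l : sorted (fun x y : 'I_n => x < y) s ->
  [seq x : 'I_n <- s | x < l] = take (count (fun x : 'I_n => x < l) s) s.
Proof.
elim: s => //= x s IHs xs; case: ifP => [_|ge_xl]; first by rewrite IHs // (path_sorted xs).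
have tr : transitive (fun x y : 'I_n => x < y) by move=> a b c; apply: ltn_trans.
have all_ge : all (fun y : 'I_n => ~~ (y < l)) s.
  by apply: sub_all (order_path_min tr xs) => y; move/negbT: ge_xl; rewrite -!leqNgt => /leq_trans h /ltnW /h.
rewrite (eq_in_filter (a2 := pred0)) ?filter_pred0; last by move=> y /(allP all_ge)/negbTE.
by rewrite (eq_in_count (a2 := pred0)) ?count_pred0 // => y /(allP all_ge)/negbTE.
Qed.

Lemma reach_ballot n (D A : {set 'I_n}) j : reach D j A -> ballot (enum D) j A.
Proof.
case/existsP=> l le_l; have sD : sorted (fun x y : 'I_n => x < y) (enum D).
  rewrite /enum_mem -enumT; apply: sorted_filter; first by move=> a b c; apply: ltn_trans.
  have := iota_ltn_sorted 0 n; rewrite -val_enum_ord sorted_map.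
  by rewrite (eq_sorted (e' := fun x y : 'I_n => x < y)).
have uf := filter_uniq (fun x : 'I_n => x < l) (enum_uniq D).
apply: (@take_ballot _ _ (count (fun x : 'I_n => x < l) (enum D))).
  exact: count_size.
rewrite -filter_ltn_sorted // -size_filter -(elimT card_uniqP uf).
have pE : pre D l = [set x in [seq x : 'I_n <- enum D | x < l]].
  by apply/setP=> x; rewrite !inE mem_filter mem_enum andbC.
rewrite -(eq_card (A := pre D l)); last by move=> x; rewrite pE inE.
rewrite (_ : count _ _ = #|A :&: pre D l|) //; rewrite (card_subset_count uf); last by rewrite -pE subsetIr.
apply: eq_in_count => x; rewrite mem_filter mem_enum => /andP[xl xD] /=.
by rewrite !inE xl xD !andbT.
Qed.

Lemma reach_leq_card n (D A : {set 'I_n}) j : reach D j A -> j <= #|A :&: D|.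
Proof.
case/existsP=> l; have : #|A :&: pre D l| <= #|A :&: D|.
  by apply: subset_leq_card; apply: setIS; apply/subsetP=> x; rewrite inE => /andP[].
have : #|A :&: pre D l| <= #|pre D l| by apply: subset_leq_card (subsetIr _ _).
by lia.
Qed.

(** Removing [f] leaves [k - #|f|] points outside [f] and [g], and [card_ballot] applies. The value
    is 0 when too few points remain to climb [j]. *)
Lemma card_reach (n k j : nat) (D f g : {set 'I_n}) :
    [disjoint D & f] -> [disjoint D & g] -> [disjoint f & g] ->
  #|[set A : {set 'I_n} | [&& #|A| == k, f \subset A, [disjoint A & g] & reach D j A]]|
     <= if #|f| + j <= k then 'C(n - #|f| - #|g|, k - #|f| - j) else 0.
Proof.
move=> Df Dg fg; set E := [set A : {set 'I_n} | _].
have EP A : A \in E -> [/\ #|A| = k, f \subset A, [disjoint A & g] & reach D j A].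
  by rewrite inE => /and4P[/eqP].
case: ifP => [le_k|/negbT lt_k]; last first.
  rewrite leqn0 cards_eq0 -subset0; apply/subsetP => A /EP[cA fA gA /reach_leq_card]; rewrite inE.
  have : #|f :|: A :&: D| <= #|A| by apply: subset_leq_card; rewrite subUset fA subsetIl.
  rewrite cardsU (_ : f :&: _ = set0) ?cards0; first by lia.
  by apply: disjoint_setI0; rewrite disjoint_sym; apply: disjointWl (subsetIr _ _) Df.
(* The points of [D] come first, so the path along [D] is an initial part of the word [s]. *)
pose r := enum (~: (D :|: f :|: g)); set s := enum D ++ r.
have us : uniq s.
  rewrite cat_uniq !enum_uniq andbT /=; apply/hasPn=> x; rewrite !mem_enum !inE.
  by rewrite !negb_or => /andP[/andP[]].
have inS x : (x \in s) = (x \notin f :|: g).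
  rewrite mem_cat !mem_enum !inE; case: (boolP (x \in D)) => //= xD.
  by rewrite (disjointFr Df xD) (disjointFr Dg xD).
have cs : size s = n - #|f| - #|g|.
  rewrite -(elimT card_uniqP us) (_ : #|s| = #|~: (f :|: g)|); last by apply: eq_card => x; rewrite [RHS]inE -inS.
  have := cardsC (f :|: g); rewrite cardsU (disjoint_setI0 fg) cards0 card_ord; lia.
rewrite -cs -(card_in_imset (f := fun A => A :\: f)); last first.
  move=> A B /EP[_ fA _ _] /EP[_ fB _ _] eqAB.
  by rewrite -(setID A f) -(setID B f) eqAB (setIidPr fA) (setIidPr fB).
apply: leq_trans (card_ballot (k - #|f| - j) j us).
apply/subset_leq_card/subsetP=> _ /imsetP[A /EP[cA fA gA rA] ->]; rewrite inE; apply/and3P; split.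
- apply/subsetP=> x; rewrite !inE inS !inE negb_or => /andP[-> xA] /=.
  by rewrite (disjointFr gA xA).
- by rewrite cardsD (setIidPr fA) cA; apply/eqP; lia.
- apply: ballot_catl; rewrite (@eq_in_ballot _ _ _ _ A) ?reach_ballot // => x.
  by rewrite mem_enum !inE => xD; rewrite (disjointFr Df xD).
Qed.
(* Coercing 'I_n to a finite type leaves reverse_coercion markers, which hide
   equal cardinals from lia. *)
Ltac olia := unfold reverse_coercion in *; lia.

(** * Shift-stable intersecting families *)

Definition stable (n : nat) (F : {set {set 'I_n}}) (D : {set 'I_n}) : Prop :=
  forall (i j : 'I_n) (A : {set 'I_n}),
    i \in D -> j \in D -> i < j -> A \in F -> j \in A -> i \notin A -> i |: (A :\ j) \in F.

Lemma stableS n (F : {set {set 'I_n}}) (D D' : {set 'I_n}) :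
  D' \subset D -> stable F D -> stable F D'.
Proof. by move=> /subsetP sD stF i j A iD jD; apply: stF; apply: sD. Qed.

Lemma pre_minn n (D : {set 'I_n}) l : pre D l = pre D (minn l n).
Proof. by apply/setP=> x; rewrite !inE leq_min ltn_ord andbT. Qed.

(** Descent on [#|A :&: B|]. If no prefix overflows, counting up to the least common point [x] finds
    a smaller [y] in [D] missed by both sets. Replacing [x] by [y] in [B] stays in [F] and shrinks
    the intersection, which can never become empty. *)
Lemma cross_intersecting_prefix n (F : {set {set 'I_n}}) (D A B : {set 'I_n}) :
    intersecting F -> stable F D -> A \in F -> B \in F -> A :&: B \subset D ->
  exists l, #|pre D l| < #|A :&: pre D l| + #|B :&: pre D l|.
Proof.
move=> intF stF AF; have [m] := ubnP #|A :&: B|; elim: m B => // m IHm B cm BF sD.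
have [/existsP[l lt_l]|/existsPn noL] :=
  boolP [exists l : 'I_n.+1, #|pre D l| < #|A :&: pre D l| + #|B :&: pre D l|].
  by exists l.
have {}noL l : #|A :&: pre D l| + #|B :&: pre D l| <= #|pre D l|.
  have := noL (inord (minn l n)); rewrite inordK ?ltnS ?geq_minr // -leqNgt.
  by rewrite -pre_minn.
have /set0Pn[x0 x0AB] := intF A B AF BF.
case: (arg_minnP (fun x : 'I_n => x : nat) x0AB) => x xAB0 minx.
have xAB : x \in A :&: B := xAB0.
have xD : x \in D by apply: (subsetP sD).
have /andP[xA xB] : (x \in A) && (x \in B) by rewrite -in_setI.
have [y /and4P[yD yx yA yB]] : exists y : 'I_n, [&& y \in D, y < x, y \notin A & y \notin B].
  apply/existsP; apply: contraT => /existsPn noy.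
  have := noL x.+1; rewrite -cardsUI leqNgt => /negP[].
  apply: (@leq_ltn_trans #|A :&: pre D x.+1 :|: B :&: pre D x.+1|).
    apply/subset_leq_card/subsetP=> y; rewrite !inE => /andP[yD]; rewrite ltnS yD => yx.
    rewrite yx !andbT; move: yx; rewrite leq_eqVlt => /orP[/eqP/val_inj->|yx]; first by rewrite xA.
    by have := noy y; rewrite yD yx /= -negb_or negbK.
  rewrite -[X in X < _]addn0 ltn_add2l card_gt0; apply/set0Pn; exists x.
  by rewrite !inE xA xB xD ltnSn.
have yNx : y != x by apply: contraTneq yx => ->; rewrite ltnn.
pose B' := y |: (B :\ x).
have B'F : B' \in F by apply: stF.
have AB' : A :&: B' = (A :&: B) :\ x.
  apply/setP=> z; rewrite !inE; case: (eqVneq z y) => [->|zy] /=; first by rewrite (negbTE yA) andbF.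
  by rewrite andbCA.
have cm' : #|A :&: B'| < m.
  by move: cm; rewrite (cardsD1 x) xAB AB' ltnS.
have sD' : A :&: B' \subset D by rewrite AB'; apply: subset_trans (subsetDl _ _) sD.
have [l lt_l] := IHm B' cm' B'F sD'; exfalso; move: lt_l; apply/negP; rewrite -leqNgt.
(* Trading x for the smaller y can break the prefix bound only between y and x,
   where A and B are still disjoint and both miss y. *)
case: (leqP l y) => [le_ly|lt_yl].
  rewrite (_ : B' :&: pre D l = B :&: pre D l) //; apply/setP=> z; rewrite !inE.
  case: (ltnP z l) => [zl|]; rewrite ?andbF //.
  have /negbTE-> : z != y by apply: contraTneq zl => ->; rewrite -leqNgt.
  have /negbTE-> // : z != x by apply: contraTneq zl => ->; rewrite -leqNgt (leq_trans le_ly) // ltnW.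
have cB' : #|B' :&: pre D l| = (#|(B :&: pre D l) :\ x|).+1.
  rewrite (_ : B' :&: _ = y |: ((B :&: pre D l) :\ x)); last first.
    by apply/setP=> z; rewrite !inE; case: eqP => [->|_] /=; rewrite ?yD ?lt_yl ?andbA.
  by rewrite cardsU1 !inE (negbTE yB) /= andbF.
case: (ltnP x l) => [lt_xl|le_lx].
  by apply: leq_trans (noL l); rewrite cB' (cardsD1 x (B :&: _)) !inE xB xD lt_xl.
have disj : A :&: pre D l :&: (B :&: pre D l) = set0.
  apply/setP=> z; rewrite !inE; apply/negP=> /andP[/and3P[zA _ zl] /andP[zB _]].
  have zAB : z \in A :&: B by rewrite inE zA zB.
  by have := minx z zAB; rewrite leqNgt (leq_trans zl le_lx).
rewrite cB' (_ : _ :\ x = B :&: pre D l); last first.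
  by apply/setP=> z; rewrite !inE; case: eqP => //= ->; rewrite ltnNge le_lx !andbF.
rewrite addnS -cardsUI disj cards0 addn0.
apply: proper_card; apply/properP; split; first by rewrite subUset !subsetIr.
by exists y; rewrite !inE ?yD ?lt_yl // (negbTE yA) (negbTE yB).
Qed.

(** Only nonempty prefixes count: the empty one has height 0, and [low D 0 A] is to mean strictly
    below 0 from the first step on. *)
Definition low (n : nat) (D : {set 'I_n}) (j : nat) (A : {set 'I_n}) : Prop :=
  forall l, pre D l != set0 -> 2 * #|A :&: pre D l| < #|pre D l| + j.

Lemma low_or_reach n (D A : {set 'I_n}) j : low D j A \/ reach D j A.
Proof.
case: (boolP (reach D j A)) => [|/negP noR]; [by right | left=> l _].
by rewrite ltnNge; apply/negP => /reachI.
Qed.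

Definition first (n : nat) (D : {set 'I_n}) (u : 'I_n) : Prop :=
  u \in D /\ {in D, forall x : 'I_n, u <= x}.

Lemma firstP n (D : {set 'I_n}) : D != set0 -> exists u, first D u.
Proof.
case/set0Pn=> x0 x0D; case: (arg_minnP (fun x : 'I_n => x : nat) x0D) => x xD minx.
by exists x; split=> // y yD; apply: minx.
Qed.

Lemma card_pre_first n (D : {set 'I_n}) u l : first D u -> pre D l != set0 ->
  #|pre D l| = (#|pre (D :\ u) l|).+1.
Proof.
case=> uD minu /set0Pn[x]; rewrite inE => /andP[xD xl].
rewrite (cardsD1 u) inE uD (leq_ltn_trans (minu x xD) xl); congr (_.+1).
by apply: eq_card => y; rewrite !inE andbA.
Qed.

Lemma setI_pre_first n (D A : {set 'I_n}) u l : u \notin A ->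
  A :&: pre (D :\ u) l = A :&: pre D l.
Proof.
move=> uA; apply/setP=> y; rewrite !inE; case: eqP => // ->.
by rewrite (negbTE uA).
Qed.

Lemma low_first n (D A : {set 'I_n}) u j :
  first D u -> u \notin A -> low (D :\ u) j.+1 A -> low D j A.
Proof.
move=> fu uA lowA l ne; rewrite (card_pre_first fu ne) -(setI_pre_first D l uA).
case: (eqVneq (pre (D :\ u) l) set0) => [->|/lowA]; last by olia.
by rewrite setI0 cards0.
Qed.

Lemma low_behead n (D A : {set 'I_n}) u j :
  first D u -> u \notin A -> low D j A -> low (D :\ u) j.+1 A.
Proof.
move=> fu uA lowA l ne; have ne' : pre D l != set0.
  by case/set0Pn: ne => x; rewrite !inE => /andP[/andP[_ xD] xl]; apply/set0Pn; exists x; rewrite inE xD.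
by have := lowA l ne'; rewrite (card_pre_first fu ne') -(setI_pre_first D l uA); olia.
Qed.

(** Exchange the first point [f] of [A] in [D] for [u]. Along [D :\ u] the path drops by 2 from [f]
    on, and before [f] it has only down steps. *)
Lemma low_shift n (F : {set {set 'I_n}}) (D A : {set 'I_n}) u j :
    stable F D -> first D u -> A \in F -> u \notin A -> A :&: D != set0 ->
    low (D :\ u) j.+2 A ->
  exists B, [/\ B \in F, u \in B, B :\: D = A :\: D & low (D :\ u) j B].
Proof.
move=> stF [uD minu] AF uA /firstP[f [fAD minf]] lowA.
have /andP[fA fD] : (f \in A) && (f \in D) by rewrite -in_setI.
have fNu : f != u by apply: contraNneq uA => <-.
have ltuf : u < f by rewrite ltn_neqAle eq_sym fNu minu.
exists (u |: (A :\ f)); split; first exact: stF.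
- by rewrite !inE eqxx.
- apply/setP=> z; rewrite !inE; case: (eqVneq z u) => [->|_]; first by rewrite uD.
  by case: eqP => [->|//]; rewrite fD.
move=> l ne; have -> : (u |: A :\ f) :&: pre (D :\ u) l = (A :&: pre (D :\ u) l) :\ f.
  apply/setP=> z; rewrite !inE; case: (eqVneq z u) => [->|_] /=; first by rewrite !andbF.
  by rewrite -!andbA.
case: (ltnP f l) => [ltfl|lelf].
  have := lowA l ne; rewrite (cardsD1 f (A :&: _)) !inE fA fNu fD ltfl /=; olia.
rewrite (_ : _ :\ f = set0) ?cards0; first by rewrite muln0 addn_gt0 card_gt0 ne.
apply/setP=> z; rewrite !inE; apply/negP=> /and3P[_ zA /andP[/andP[_ zD] zl]].
by have := minf z; rewrite inE zA zD => /(_ isT); rewrite leqNgt (leq_trans zl lelf).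
Qed.

(** * Deep sets and counts by trace *)

Definition deep (n : nat) (F : {set {set 'I_n}}) (W e : {set 'I_n}) : Prop :=
  exists B, [/\ B \in F, e \subset B, [disjoint B & W :\: e] & low (~: (W :|: e)) 0 B].

Definition num (n : nat) (F : {set {set 'I_n}}) (X Y : {set 'I_n}) : nat :=
  #|[set A in F | (X \subset A) && [disjoint A & Y]]|.

(** Both [W :\: e] and [W :|: e] are unchanged when points of [e] enter or leave [W], so deepness is
    too. *)
Lemma deep_setD n (F : {set {set 'I_n}}) (W W' e : {set 'I_n}) :
  W :\: e = W' :\: e -> deep F W e -> deep F W' e.
Proof.
move=> eqW [B [BF eB dB lB]]; exists B; split; rewrite -?eqW //.
suff <- : W :|: e = W' :|: e by [].
by apply/setP=> x; move/setP/(_ x): eqW; rewrite !inE; case: (x \in e); rewrite ?orbT ?orbF.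
Qed.

Lemma numS n (F : {set {set 'I_n}}) (X X' Y Y' : {set 'I_n}) :
  X' \subset X -> Y' \subset Y -> num F X Y <= num F X' Y'.
Proof.
move=> sX sY; apply/subset_leq_card/subsetP=> A; rewrite !inE => /and3P[-> XA dA] /=.
by rewrite (subset_trans sX XA) (disjointWr sY dA).
Qed.

Lemma disjoint_setU1r (T : finType) (A B : {set T}) x :
  [disjoint A & x |: B] = (x \notin A) && [disjoint A & B].
Proof. by rewrite !disjoints_subset setCU subsetI [A \subset ~: [set x]]subsetC sub1set inE. Qed.

Lemma num_split n (F : {set {set 'I_n}}) (X Y : {set 'I_n}) w :
  num F X Y = num F (w |: X) Y + num F X (w |: Y).
Proof.
rewrite /num -(cardsID [set A : {set 'I_n} | w \in A]); congr (_ + _); apply: eq_card => A; rewrite !inE.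
  by rewrite subUset sub1set -!andbA; case: (w \in A); rewrite ?andbT ?andbF.
by rewrite disjoint_setU1r; case: (w \in A); rewrite /= ?andbF ?andbT.
Qed.

(** * Bounds on the number of members with a given trace *)

Section Counting.

Variables (n k : nat) (F : {set {set 'I_n}}).
Hypotheses (intF : intersecting F) (uniF : uniform k F) (k_ge3 : 3 <= k).
Implicit Types (D W X Y e f A B : {set 'I_n}) (u w x y : 'I_n).

Local Notation N := (num F).
Local Notation c := 'C(n - 3, k - 3).

Lemma num_reach_leq X Y D j : [disjoint D & X] -> [disjoint D & Y] -> [disjoint X & Y] ->
    (forall A, A \in F -> X \subset A -> [disjoint A & Y] -> reach D j A) ->
  N X Y <= if #|X| + j <= k then 'C(n - #|X| - #|Y|, k - #|X| - j) else 0.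
Proof.
move=> DX DY XY allR; apply: leq_trans (card_reach k j DX DY XY).
apply/subset_leq_card/subsetP=> A; rewrite !inE => /and3P[AF XA AY].
by rewrite (uniF AF) eqxx XA AY allR.
Qed.

(** The points of [X] and the climb [j] use up 3 of the [k] points, whence the lower index [k - 3];
    fixing at least 3 points in [X] and [Y] brings the upper index down to [n - 3]. *)
Lemma num_reach_leq_c X Y D j : [disjoint D & X] -> [disjoint D & Y] -> [disjoint X & Y] ->
    (forall A, A \in F -> X \subset A -> [disjoint A & Y] -> reach D j A) ->
    #|X| + j = 3 -> 3 <= #|X| + #|Y| -> N X Y <= c.
Proof.
move=> DX DY XY allR Xj XY3; apply: leq_trans (num_reach_leq DX DY XY allR) _.
by rewrite Xj k_ge3 -!subnDA Xj leq_bin2l // leq_sub2l.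
Qed.

Lemma num_triple X Y : #|X| = 3 -> N X Y <= c.
Proof.
move=> cX; apply: leq_trans (numS F (subxx X) (sub0set Y)) _.
have d0 D : [disjoint D & set0] by rewrite disjoints_subset setC0 subsetT.
apply: (@num_reach_leq_c X set0 set0 0); rewrite ?cX //; first by rewrite disjoint_sym.
move=> A _ _ _; apply: (@reachI _ _ _ _ 0).
by rewrite (_ : pre _ _ = set0) ?cards0 //; apply/setP=> x; rewrite !inE.
Qed.

(* Two members that are disjoint off D must overlap in a prefix of D, so a
   deep member forces a surplus of 3 on every member avoiding e. *)
Lemma deep_cover W e f : stable F (~: W) -> deep F W e -> f \subset W :\: e ->
  N f e <= if #|f| + 3 <= k then 'C(n - #|f| - #|e|, k - #|f| - 3) else 0.
Proof.
move=> stF [B [BF eB dB lB]] fW.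
have stF' : stable F (~: (W :|: e)) by apply: stableS stF; rewrite setCS subsetUl.
have [fW1 fe] : f \subset W /\ [disjoint f & e] by move: fW; rewrite subsetD => /andP.
apply: (@num_reach_leq f e (~: (W :|: e)) 3) => //.
- by rewrite disjoints_subset setCS (subset_trans fW1) ?subsetUl.
- by rewrite disjoints_subset setCS subsetUr.
move=> A AF _ Ae; have [|l lt_l] := cross_intersecting_prefix intF stF' AF BF.
  apply/subsetP=> x; rewrite !inE negb_or => /andP[xA xB]; rewrite (disjointFr Ae xA) andbT.
  by have := disjointFr dB xB; rewrite !inE (disjointFr Ae xA) /= => ->.
apply: (@reachI _ _ _ _ l).
have ne : pre (~: (W :|: e)) l != set0.
  by apply: contraTneq lt_l => ->; rewrite !setI0 cards0.
by have := lB l ne; olia.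
Qed.

(** A member counted here misses [u]. Staying below 1 after [u] would mean staying below 0 from [u]
    on, making [e] deep; so it climbs to 1, and [#|e| + 1 = 3]. *)
Lemma num_deep_pair_base W e u : first (~: W) u -> e \subset W -> #|e| = 2 ->
  ~ deep F W e -> N e (u |: (W :\: e)) <= c.
Proof.
move=> fu eW ce ndeep; have uW : u \notin W by case: fu; rewrite inE.
have We : W :|: e = W by apply/setUidPl.
have ue : u \notin e by apply: contraNN uW => /(subsetP eW).
apply: (@num_reach_leq_c _ _ (~: W :\ u) 1).
- by rewrite disjoints_subset; apply/subsetP => x; rewrite !inE => /andP[_]; apply: contraNN => /(subsetP eW).
- by rewrite disjoints_subset; apply/subsetP => x; rewrite !inE => /andP[/negbTE-> /negbTE->]; rewrite andbF.
- by rewrite disjoint_setU1r ue disjoints_subset; apply/subsetP=> x; rewrite !inE => ->.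
- move=> A AF eA; rewrite disjoint_setU1r => /andP[uA dA].
  have [lA|//] := low_or_reach (~: W :\ u) A 1.
  case: ndeep; exists A; rewrite We; split=> //; exact: low_first lA.
- by rewrite ce.
- by rewrite ce cardsU1 !inE (negbTE uW) andbF.
Qed.

(** One [c] for each further point of [u |: W] that a member may contain, by [num_triple], and one
    for the members whose trace on [u |: W] is exactly [e]. *)
Lemma num_pair m W e u Y : first (~: W) u -> e \subset W -> #|e| = 2 ->
  ~ deep F W e -> #|(u |: W) :\: (e :|: Y)| <= m -> N e Y <= m.+1 * c.
Proof.
move=> fu eW ce ndeep; elim: m Y => [|m IHm] Y cY.
  rewrite mul1n; apply: leq_trans (num_deep_pair_base fu eW ce ndeep); apply: numS => //.
  apply/subsetP=> x; move: cY; rewrite leqn0 cards_eq0 => /eqP/setP/(_ x); rewrite !inE.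
  have uW : u \notin W by case: fu; rewrite inE.
  case: (x \in Y); rewrite // orbF; case: (boolP (x \in e)) => [/(subsetP eW) xW|_] /=.
    by rewrite orbF => _ /eqP xu; move: uW; rewrite -xu xW.
  by move=> ->.
have [/eqP|/set0Pn[w]] := boolP ((u |: W) :\: (e :|: Y) == set0).
  move=> e0; apply: leq_trans (IHm Y _) _; first by rewrite e0 cards0.
  by rewrite leq_mul2r leqnSn orbT.
move=> wD; rewrite (num_split F e Y w) [m.+2 * _]mulSn; apply: leq_add.
  apply: num_triple; move: wD; rewrite !inE negb_or => /andP[/andP[we _] _].
  by rewrite cardsU1 we ce.
apply: IHm; move: cY; rewrite (cardsD1 w) wD ltnS; apply: leq_trans.
apply/subset_leq_card/subsetP=> x; rewrite !inE !negb_or.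
by case: (x == w); rewrite ?andbF.
Qed.

Lemma shift_ne A D : A \in F -> #|A :\: D| < k -> A :&: D != set0.
Proof.
move=> AF; apply: contraTneq => AD0; rewrite -leqNgt -(uniF AF).
by rewrite -{1}(setID A D) AD0 set0U.
Qed.

(** Members through [u] number at most [2 * c] by [num_pair]. One that misses [u] climbs to 2, which
    allows [c] of them; otherwise [low_shift] turns it into a witness that [[set x; u]] is deep. *)
Lemma num_single_base W x u : stable F (~: W) -> 1 < #|W| -> #|W| + 2 <= n ->
  first (~: W) u -> x \in W -> ~ deep F W [set x; u] -> N [set x] (W :\ x) <= 3 * c.
Proof.
move=> stF W1 Wn fu xW ndeep; have uW : u \notin W by case: fu; rewrite inE.
have xu : x != u by apply: contraNneq uW => <-.
rewrite (num_split F _ _ u) -[3]/(2 + 1) mulnDl mul1n; apply: leq_add.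
  have [|u' fu'] := @firstP _ (~: (u |: W)).
    by rewrite -card_gt0 cardsCs setCK cardsU1 uW card_ord; lia.
  apply: (@num_pair 1 (u |: W) _ u') => //.
  - by rewrite setUC subUset !sub1set !inE eqxx xW orbT.
  - by rewrite cards2 eq_sym xu.
  - move=> d; apply: ndeep; rewrite setUC; apply: deep_setD d.
    by apply/setP=> z; rewrite !inE; case: (z == u).
  - rewrite -(cards1 u'); apply/subset_leq_card/subsetP=> z; rewrite !inE.
    by case: (z == u'); case: (z == u); case: (z == x); case: (z \in W).
apply: (@num_reach_leq_c _ _ (~: W :\ u) 2).
- by rewrite disjoint_sym disjoints1 !inE xW andbF.
- rewrite disjoints_subset; apply/subsetP => z; rewrite !inE => /andP[/negbTE-> /negbTE->].
  by rewrite andbF.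
- by rewrite disjoints1 !inE eqxx (negbTE xu).
- move=> A AF; rewrite sub1set => xA; rewrite disjoint_setU1r => /andP[uA dA].
  have [lA|//] := low_or_reach (~: W :\ u) A 2.
  have AW z : z \in A -> z \in W -> z = x.
    by move=> zA zW; have := disjointFr dA zA; rewrite !inE zW andbT => /negbFE/eqP.
  have ne : A :&: ~: W != set0.
    apply: shift_ne AF _; apply: leq_ltn_trans k_ge3.
    rewrite (leq_trans (n := 1)) // -(cards1 x); apply/subset_leq_card/subsetP => z.
    by rewrite !inE negbK => /andP[zW zA]; rewrite (AW z).
  have [B [BF uB BA lB]] := low_shift stF fu AF uA ne lA.
  have BW z : z \in W -> (z \in B) = (z \in A).
    by move=> zW; move/setP/(_ z): BA; rewrite !inE zW.
  case: ndeep; exists B; split=> //.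
  - by rewrite subUset !sub1set uB BW // xA.
  - rewrite disjoints_subset; apply/subsetP => z zB; rewrite !inE negb_and negbK.
    case: (boolP (z \in W)) => zW; rewrite ?orbT // orbF.
    by move: zB; rewrite BW // => /AW-> //; rewrite eqxx.
  suff -> : ~: (W :|: [set x; u]) = ~: W :\ u by [].
  apply/setP=> z; rewrite !inE !negb_or; case: (boolP (z \in W)) => zW /=; rewrite ?andbF //.
  by rewrite andbT; case: eqP => // zx; move: zW; rewrite zx xW.
- by rewrite cards1.
- by move: (cardsD1 x W) W1; rewrite xW cards1 cardsU1 !inE (negbTE uW) andbF; olia.
Qed.

(** The trace [[set x]] gives [3 * c], each of the [m] possible pairs [2 * c], and each of the
    ['C(m, 2)] triples [c]. *)
Lemma num_single m W x u Y : stable F (~: W) -> 1 < #|W| -> #|W| + 2 <= n ->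
    first (~: W) u -> x \in W ->
    (forall w, w \in W :\: (x |: Y) -> ~ deep F W [set x; w]) ->
    ~ deep F W [set x; u] -> #|W :\: (x |: Y)| <= m ->
  N [set x] Y <= ('C(m, 2) + 2 * m + 3) * c.
Proof.
move=> stF W1 Wn fu xW ndw ndu; have uW : u \notin W by case: fu; rewrite inE.
elim: m Y ndw => [|m IHm] Y ndw cY.
  rewrite bin0n /= add0n; apply: leq_trans (num_single_base stF W1 Wn fu xW ndu).
  apply: numS => //; apply/subsetP=> z; rewrite !inE => /andP[zx zW].
  move: cY; rewrite leqn0 cards_eq0 => /eqP/setP/(_ z); rewrite !inE zW (negbTE zx) /= andbT.
  by move/negbFE.
have [/eqP|/set0Pn[w wD]] := boolP (W :\: (x |: Y) == set0).
  move=> e0; apply: leq_trans (IHm Y ndw _) _; first by rewrite e0 cards0.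
  by rewrite leq_mul2r binS; apply/orP; right; lia.
have /and3P[wx wY wW] : [&& w != x, w \notin Y & w \in W].
  by move: wD; rewrite !inE negb_or -andbA.
rewrite (num_split F _ Y w) binS bin1.
apply: (@leq_trans (m.+2 * c + ('C(m, 2) + 2 * m + 3) * c)); last first.
  by rewrite -mulnDl leq_mul2r; apply/orP; right; lia.
have cY' : #|(W :\: (x |: Y)) :\ w| <= m by move: cY; rewrite (cardsD1 w) wD.
apply: leq_add.
  apply: (@num_pair _ W _ u) => //.
  - by rewrite subUset !sub1set wW xW.
  - by rewrite cards2 wx.
  - by rewrite setUC; apply: ndw.
  apply: leq_trans (subset_leq_card (B := u |: ((W :\: (x |: Y)) :\ w)) _) _.
    apply/subsetP=> z; rewrite !inE; case: (z == u) => //=.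
    by case: (z == w); case: (z == x); case: (z \in Y).
  by rewrite cardsU1 -add1n; apply: leq_add => //; case: (_ \notin _).
apply: IHm.
  by move=> z; rewrite !inE !negb_or -!andbA => /and4P[zx _ zY zW]; apply: ndw; rewrite !inE negb_or zx zY.
apply: leq_trans cY'; apply/subset_leq_card/subsetP=> z; rewrite !inE !negb_or.
by case: (z == w); rewrite ?andbF.
Qed.

(** Members through [u] are covered by [num_single_base] over [u |: W]. One that misses [u] climbs
    to 3, or two uses of [low_shift] bring in [u] and then [v] and make [[set u; v]] deep. *)
Lemma num_empty_base W u v : stable F (~: W) -> 1 < #|W| -> #|W| + 3 <= n ->
  first (~: W) u -> first (~: (u |: W)) v -> ~ deep F W [set u; v] ->
  N set0 W <= 4 * c.
Proof.
move=> stF W1 Wn fu fv ndeep; have uW : u \notin W by case: fu; rewrite inE.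
have [vu vW] : v != u /\ v \notin W by case: fv; rewrite !inE negb_or => /andP[].
have cW' : #|u |: W| = #|W|.+1 by rewrite cardsU1 uW.
have stF' : stable F (~: (u |: W)) by apply: stableS stF; rewrite setCS subsetUr.
have DE : ~: (u |: W) = ~: W :\ u by apply/setP=> z; rewrite !inE negb_or.
rewrite (num_split F _ _ u) setU0 -[4]/(3 + 1) mulnDl mul1n; apply: leq_add.
  have WE : W = (u |: W) :\ u by rewrite setU1K.
  have W1' : 1 < #|u |: W| by rewrite cW' ltnW.
  have Wn' : #|u |: W| + 2 <= n by rewrite cW' addSnnS.
  rewrite {1}WE; apply: (num_single_base stF' W1' Wn' fv); first exact: setU11.
  move=> d; apply: ndeep; apply: deep_setD d; apply/setP=> z; rewrite !inE.
  by case: (z == u).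
apply: (@num_reach_leq_c _ _ (~: W :\ u) 3).
- by rewrite disjoints_subset setC0 subsetT.
- by rewrite -DE disjoints_subset.
- by rewrite disjoint_sym disjoints_subset setC0 subsetT.
- move=> A AF _; rewrite disjoint_setU1r => /andP[uA dA].
  have [lA|//] := low_or_reach (~: W :\ u) A 3.
  have neA (B : {set 'I_n}) V : B \in F -> #|B :&: V| < k -> B :&: ~: V != set0.
    move=> BF lk; apply: shift_ne BF _; apply: leq_ltn_trans lk.
    by apply/subset_leq_card/subsetP=> z; rewrite !inE negbK andbC.
  have ne : A :&: ~: W != set0.
    by apply: neA => //; rewrite (disjoint_setI0 dA) cards0 (leq_trans _ k_ge3).
  have [B [BF uB BA lB]] := low_shift stF fu AF uA ne lA.
  have BW z : z \in W -> z \notin B.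
    move=> zW; move/setP/(_ z): BA; rewrite !inE zW /= => ->.
    by rewrite (disjointFl dA zW).
  (* [B] stays below 1 along a path whose first point is [v]; an up step there would reach 1. *)
  have vB : v \notin B.
    have pv : pre (~: (u |: W)) v.+1 = [set v].
      apply/setP=> z; case: fv => vD minv; rewrite inE in_set1 ltnS.
      apply/andP/eqP => [[zD zv]|-> //]; apply/val_inj/eqP.
      by rewrite eqn_leq zv minv.
    have v0 : [set v] != set0 by apply/set0Pn; exists v; rewrite inE.
    have := lB v.+1; rewrite -DE pv => /(_ v0).
    by apply: contraTN => vB; rewrite (setIidPr _) ?cards1 // sub1set.
  rewrite -DE in lB.
  have neB : B :&: ~: (u |: W) != set0.
    apply: neA => //; apply: leq_ltn_trans (leq_trans _ k_ge3 : 1 < k); last by [].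
    rewrite -(cards1 u); apply/subset_leq_card/subsetP=> z; rewrite !inE => /andP[zB].
    by case/orP=> // /BW; rewrite zB.
  have [C [CF vC CB lC]] := low_shift stF' fv BF vB neB (low_behead fv vB lB).
  have CW z : z \in u |: W -> (z \in C) = (z == u).
    move=> zW; move/setP/(_ z): (CB); rewrite !inE negbK -in_setU1 zW /= => ->.
    by move: zW; rewrite !inE => /orP[/eqP->|zW]; rewrite ?uB ?eqxx // (negbTE (BW z zW)); apply/esym; apply: contraTF zW => /eqP->.
  case: ndeep; exists C; split=> //.
  - by rewrite subUset !sub1set vC CW ?eqxx // setU11.
  - rewrite disjoints_subset; apply/subsetP=> z zC; rewrite !inE negb_and negbK.
    case: (boolP (z \in W)) => zW; rewrite ?orbT // orbF.
    by rewrite -(CW z) ?zC // inE zW orbT.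
  suff -> : ~: (W :|: [set u; v]) = ~: (u |: W) :\ v by [].
  by apply/setP=> z; rewrite !inE !negb_or; case: (z == u); case: (z == v); rewrite ?andbF ?andbT.
- by rewrite cards0.
by rewrite cards0 cW' ltnS.
Qed.

(* With m = #|W :\: Y|, a trace on W of size 3, 2, 1 or 0 contributes at most
   c, 2c, 3c or 4c members. *)
Lemma num_avoid m W u v Y : stable F (~: W) -> 1 < #|W| -> #|W| + 3 <= n ->
    first (~: W) u -> first (~: (u |: W)) v ->
    (forall x w, x \in W -> w \in W -> w != x -> ~ deep F W [set x; w]) ->
    (forall x, x \in W -> ~ deep F W [set x; u]) -> ~ deep F W [set u; v] ->
    #|W :\: Y| <= m ->
  N set0 Y <= ('C(m, 3) + 2 * 'C(m, 2) + 3 * m + 4) * c.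
Proof.
move=> stF W1 Wn fu fv ndp nds nde; have Wn2 : #|W| + 2 <= n by lia.
elim: m Y => [|m IHm] Y cY.
  rewrite !bin0n /=; apply: leq_trans (num_empty_base stF W1 Wn fu fv nde).
  by apply: numS => //; rewrite -setD_eq0 -cards_eq0 -leqn0.
have [/eqP|/set0Pn[w wD]] := boolP (W :\: Y == set0).
  move=> e0; apply: leq_trans (IHm Y _) _; first by rewrite e0 cards0.
  by rewrite leq_mul2r !binS; apply/orP; right; lia.
have /andP[wY wW] : (w \notin Y) && (w \in W) by move: wD; rewrite !inE.
have cY' : #|W :\: (w |: Y)| <= m.
  move: cY; rewrite (cardsD1 w) wD ltnS; apply: leq_trans.
  apply/subset_leq_card/subsetP=> z; rewrite !inE negb_or.
  by case: (z == w).
rewrite (num_split F _ Y w) setU0 !binS bin1.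
apply: (@leq_trans (('C(m, 2) + 2 * m + 3) * c + ('C(m, 3) + 2 * 'C(m, 2) + 3 * m + 4) * c)); last first.
  by rewrite -mulnDl leq_mul2r; apply/orP; right; lia.
apply: leq_add; last exact: IHm.
apply: (num_single stF W1 Wn2 fu wW) => //; last exact: nds.
by move=> z; rewrite !inE negb_or => /andP[/andP[zw _] zW]; apply: ndp.
Qed.

End Counting.

Lemma lowP n (D A : {set 'I_n}) j : reflect (low D j A)
  [forall l : 'I_n.+1, (pre D l != set0) ==> (2 * #|A :&: pre D l| < #|pre D l| + j)].
Proof.
apply: (iffP forallP) => [h l ne|h l]; last by apply/implyP; apply: h.
have := h (inord (minn l n)); rewrite inordK ?ltnS ?geq_minr // -pre_minn.
by rewrite ne.
Qed.

Lemma deep_dec n (F : {set {set 'I_n}}) W e : decidable (deep F W e).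
Proof.
apply: (@decP _ [exists B, [&& B \in F, e \subset B, [disjoint B & W :\: e] &
  [forall l : 'I_n.+1, (pre (~: (W :|: e)) l != set0) ==>
     (2 * #|B :&: pre (~: (W :|: e)) l| < #|pre (~: (W :|: e)) l| + 0)]]]).
apply: (iffP existsP) => [[B /and4P[BF eB dB /lowP lB]]|[B [BF eB dB /lowP lB]]].
  by exists B.
by exists B; rewrite BF eB dB.
Qed.

(** * Triangles of deep pairs under the degree bound *)

Section Structure.

Variables (n k : nat) (F : {set {set 'I_n}}).
Hypotheses (intF : intersecting F) (uniF : uniform k F) (k_ge3 : 3 <= k) (n_ge8 : 8 <= n).
Implicit Types (P Q W X Y e f A B : {set 'I_n}) (u v w x y z p q : 'I_n).

Local Notation N := (num F).
Local Notation c := 'C(n - 3, k - 3).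
Local Notation c' := (if 4 <= k then 'C(n - 3, k - 4) else 0).

Hypotheses (F_ge : 48 * c <= #|F|) (c'_le : 2 * c' <= c) (c_gt0 : 0 < c).

Lemma disjoint_set0r A : [disjoint A & set0].
Proof. by rewrite disjoints_subset setC0 subsetT. Qed.

Lemma disjoint_set1r A x : [disjoint A & [set x]] = (x \notin A).
Proof. by rewrite -[[set x]]setU0 disjoint_setU1r disjoint_set0r andbT. Qed.

Lemma disjoint_set2r A x y : [disjoint A & [set x; y]] = (x \notin A) && (y \notin A).
Proof. by rewrite disjoint_setU1r disjoint_set1r. Qed.

Lemma num_sum X Y : N X Y = \sum_(A in F) ((X \subset A) && [disjoint A & Y]).
Proof.
rewrite /num -sum1_card big_mkcond [RHS]big_mkcond; apply: eq_bigr => A _.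
by rewrite inE; case: (A \in F) => //=; case: ifP.
Qed.

(** Counts become sums of indicators, so inequalities between them reduce to Boolean cases for one
    member. *)
Definition numE := (num_sum, subUset, sub1set, sub0set, disjoint_setU1r,
  disjoint_set1r, disjoint_set0r, andbT).

(** [deep_cover] with empty [f] gives ['C(n - 2, k - 3)], which is [c + c'] by Pascal's rule. *)
Lemma deep_pair_leq W x y : stable F (~: W) -> x != y -> deep F W [set x; y] ->
  N set0 [set x; y] <= 2 * c.
Proof.
move=> stF xy d; apply: leq_trans (deep_cover intF uniF k_ge3 stF d (sub0set _)) _.
rewrite cards0 cards2 xy k_ge3 !subn0; move: c'_le.
have -> : n - 2 = (n - 3).+1 by olia.
case: ifP => k4; last first.
  have -> : k - 3 = 0 by olia.
  by rewrite !bin0.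
have -> : k - 3 = (k - 4).+1 by olia.
by rewrite binS; olia.
Qed.

Lemma deep_pair_mem_leq W x y z : stable F (~: W) -> x != y -> deep F W [set x; y] ->
  z \in W -> z != x -> z != y -> N [set z] [set x; y] <= c'.
Proof.
move=> stF xy d zW zx zy.
have zf : [set z] \subset W :\: [set x; y] by rewrite sub1set !inE zW (negbTE zx) (negbTE zy).
apply: leq_trans (deep_cover intF uniF k_ge3 stF d zf) _.
by rewrite cards1 cards2 xy -!subnDA.
Qed.

Lemma num_total x : N [set x] set0 + N set0 [set x] = #|F|.
Proof.
rewrite -[X in N X _]setU0 -[X in _ + N _ X]setU0 -num_split -sum1_card num_sum.
by apply: eq_bigr => A _; rewrite sub0set disjoint_set0r.
Qed.

(** A member contains two of the three points or avoids two of them. Hence 2|F| is at most 3|F|/2 +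
    12c, against [F_ge]. *)
Lemma triangle_deg x y z :
    N set0 [set x; y] <= 2 * c -> N set0 [set x; z] <= 2 * c -> N set0 [set y; z] <= 2 * c ->
    2 * N [set x] set0 <= #|F| -> 2 * N [set y] set0 <= #|F| -> 2 * N [set z] set0 <= #|F| ->
  False.
Proof.
move=> xy xz yz dx dy dz; suff : 2 * #|F| <= N [set x] set0 + N [set y] set0 + N [set z] set0
    + 2 * (N set0 [set x; y] + N set0 [set x; z] + N set0 [set y; z]) by olia.
rewrite !numE -sum1_card -!big_split !big_distrr -!big_split /=; apply: leq_sum => A _; rewrite !numE.
by case: (x \in A); case: (y \in A); case: (z \in A).
Qed.

(** At most 6c members avoid one of the three pairs. Any other member that meets [[set r; s]]
    contains one of six triples, which accounts for another 6c. *)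
Lemma triangle_hit x y z r s : x != y -> x != z -> y != z -> r \notin [set x; y; z] -> s \notin [set x; y; z] ->
    N set0 [set x; y] <= 2 * c -> N set0 [set x; z] <= 2 * c -> N set0 [set y; z] <= 2 * c ->
  #|F| <= N set0 [set r; s] + 12 * c.
Proof.
move=> xNy xNz yNz rT sT xy xz yz.
have t3 t a b : t \notin [set x; y; z] -> a \in [set x; y; z] -> b \in [set x; y; z] -> a != b ->
    N [set t; a; b] set0 <= c.
  move=> tT aT bT ab; apply: num_triple => //.
  rewrite -setUA cardsU1 cards2 ab !inE negb_or.
  by rewrite (contraNneq _ tT) ?(contraNneq _ tT) // => ->.
suff : #|F| <= N set0 [set r; s] + (N set0 [set x; y] + N set0 [set x; z] + N set0 [set y; z])
   + (N [set r; x; y] set0 + N [set r; x; z] set0 + N [set r; y; z] set0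
   + (N [set s; x; y] set0 + N [set s; x; z] set0 + N [set s; y; z] set0)).
  have xT : x \in [set x; y; z] by rewrite !inE eqxx.
  have yT : y \in [set x; y; z] by rewrite !inE eqxx orbT.
  have zT : z \in [set x; y; z] by rewrite !inE eqxx orbT.
  move: (t3 r x y rT xT yT xNy) (t3 r x z rT xT zT xNz) (t3 r y z rT yT zT yNz).
  move: (t3 s x y sT xT yT xNy) (t3 s x z sT xT zT xNz) (t3 s y z sT yT zT yNz).
  by olia.
rewrite !numE -sum1_card -!big_split /=; apply: leq_sum => A _; rewrite !numE.
by case: (x \in A); case: (y \in A); case: (z \in A); case: (r \in A); case: (s \in A).
Qed.

(** At least half of [F] avoids [x] and at most 2c members avoid both points, so 22c members contain
    [y] but not [x], and conversely. With no deep [[set y; z]], [num_single] would allow only 17c;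
    with [[set x; z]] not deep, only 6c + 2c would contain [x] but not [y]. *)
Lemma third_vertex W x y : stable F (~: W) -> x \in W -> y \in W -> x != y ->
    #|W :\: [set x; y]| <= 4 -> #|W| + 2 <= n -> N set0 [set x; y] <= 2 * c ->
    2 * N [set x] set0 <= #|F| -> 2 * N [set y] set0 <= #|F| ->
  exists z, [/\ z != x, z != y, deep F W [set x; z] & deep F W [set y; z]].
Proof.
move=> stF xW yW xy cW Wn cxy dx dy.
have cW2 : #|W| = 2 + #|W :\: [set x; y]|.
  by rewrite -(cardsID [set x; y] W) (setIidPr _) ?cards2 ?xy // subUset !sub1set xW.
have W1 : 1 < #|W| by rewrite cW2.
have [|u fu] := @firstP _ (~: W); first by rewrite -card_gt0 cardsCs setCK card_ord; olia.
have half a b : N set0 [set a; b] <= 2 * c -> 2 * N [set a] set0 <= #|F| -> 22 * c <= N [set b] [set a].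
  move=> cab da; move: (num_total a); rewrite [N set0 [set a]](num_split F _ _ b) setU0 (setUC [set b]).
  by olia.
have yx22 : 22 * c <= N [set y] [set x] by apply: half.
have xy22 : 22 * c <= N [set x] [set y] by apply: half; rewrite // setUC.
have [z [zx zy dyz]] : exists z, [/\ z != x, z != y & deep F W [set y; z]].
  have uW : u \notin W by case: fu; rewrite inE.
  have [d|nu] := deep_dec F W [set y; u].
    by exists u; split=> //; apply: contraNneq uW => ->.
  have [/existsP[w /andP[wW /sumboolP d]]|/existsPn nw] :=
    boolP [exists w, (w \in W :\: (y |: [set x])) && deep_dec F W [set y; w]].
    move: wW; rewrite !inE negb_or => /andP[/andP[wy wx] _].
    by exists w.
  have := @num_single _ _ _ uniF k_ge3 4 W y u [set x] stF W1 Wn fu yW _ nu _.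
  rewrite (_ : 'C(4, 2) = 6) //= => /(_ _ _)/wrap[].
  - by move=> w wW d; have := nw w; rewrite wW /= => /negP[]; apply/sumboolP.
  - by rewrite setUC.
  by olia.
exists z; split=> //.
have xz : x != z by rewrite eq_sym.
have [//|nd] := deep_dec F W [set x; z].
have lez : N set0 [set y; z] <= 2 * c by apply: (@deep_pair_leq W); rewrite // eq_sym.
have stF' : stable F (~: (z |: W)) by apply: stableS stF; rewrite setCS subsetUr.
have [|v fv] := @firstP _ (~: (z |: W)).
  rewrite -card_gt0 cardsCs setCK card_ord cardsU1.
  by case: (_ \notin _); olia.
have : N [set x; z] [set y] <= 6 * c.
  apply: (@num_pair _ _ _ uniF k_ge3 5 (z |: W) _ v) => //.
  - by rewrite subUset !sub1set setU11 inE xW orbT.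
  - by rewrite cards2 xz.
  - move=> d; apply: nd; apply: deep_setD d; apply/setP=> t; rewrite !inE.
    by case: (t == z); rewrite ?orbT.
  apply: leq_trans (subset_leq_card (B := v |: W :\: [set x; y]) _) _.
    apply/subsetP=> t; rewrite !inE; case: (t == v) => //=.
    by case: (t == x); case: (t == y); case: (t == z).
  by rewrite cardsU1 -add1n; apply: leq_add => //; case: (_ \notin _).
move: xy22; rewrite [N [set x] [set y]](num_split F _ _ z) (setUC [set z] [set x]) (setUC [set z] [set y]).
by have := @numS _ F [set x] set0 [set y; z] [set y; z] (sub0set _) (subxx _); olia.
Qed.

(** If every pair is avoided by more than 2c members, none is deep and [num_avoid] gives at most 32c
    members. Otherwise such a pair, added to [W], completes to a triangle; the enlarged set has at
    most 6 points, within reach of [n_ge8]. *)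
Lemma no_half_degrees W : stable F (~: W) -> 1 < #|W| -> #|W| <= 4 ->
  (forall x, 2 * N [set x] set0 <= #|F|) -> False.
Proof.
move=> stF W1 W4 deg.
have [|u fu] := @firstP _ (~: W); first by rewrite -card_gt0 cardsCs setCK card_ord; olia.
have uW : u \notin W by case: fu; rewrite inE.
have [|v fv] := @firstP _ (~: (u |: W)).
  by rewrite -card_gt0 cardsCs setCK card_ord cardsU1 uW; olia.
have [vu vW] : v != u /\ v \notin W by case: fv; rewrite !inE negb_or => /andP[].
have [/existsP[x /existsP[y /andP[xy cxy]]]|noc] :=
  boolP [exists x, exists y, (x != y) && (N set0 [set x; y] <= 2 * c)]; last first.
  have nd x y : x != y -> ~ deep F W [set x; y].
    move=> xy d; move/existsP: noc; apply; exists x; apply/existsP; exists y.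
    by rewrite xy (deep_pair_leq stF).
  have Wn : #|W| + 3 <= n by olia.
  have := @num_avoid _ _ _ uniF k_ge3 4 W u v set0 stF W1 Wn fu fv.
  rewrite setD0 (_ : 'C(4, 3) = 4) // (_ : 'C(4, 2) = 6) // => /(_ _ _ _ W4)/wrap[].
  - by move=> x w _ _ wx; apply: nd; rewrite eq_sym.
  - by move=> x xW; apply: nd; apply: contraNneq uW => <-.
  - by apply: nd; rewrite eq_sym.
  suff -> : N set0 set0 = #|F| by olia.
  by rewrite num_sum -sum1_card; apply: eq_bigr => A _; rewrite sub0set disjoint_set0r.
pose W' := [set x; y] :|: W.
have stF' : stable F (~: W') by apply: stableS stF; rewrite setCS subsetUr.
have cW' : #|W'| <= 6.
  by apply: leq_trans (leq_card_setU _ _) _; rewrite cards2 xy; olia.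
have [xW' yW'] : x \in W' /\ y \in W' by rewrite !inE !eqxx orbT.
have cWxy : #|W' :\: [set x; y]| <= 4.
  apply: leq_trans W4; apply/subset_leq_card/subsetP=> t; rewrite !inE.
  by case: (t == x); case: (t == y).
have Wn : #|W'| + 2 <= n by apply: leq_trans n_ge8; rewrite (leq_add2r 2 _ 6).
have [z [zx zy dx dy]] := third_vertex stF' xW' yW' xy cWxy Wn cxy (deg x) (deg y).
have xz : x != z by rewrite eq_sym.
have yz : y != z by rewrite eq_sym.
by apply: (@triangle_deg x y z); rewrite ?deg // (@deep_pair_leq W').
Qed.

(** * Members meeting two disjoint pairs *)

Definition hit2 P Q : nat := #|[set A in F | ~~ [disjoint A & P] && ~~ [disjoint A & Q]]|.

(** Members through [u] contain one of four triples: 4c. Of the others, those missing [p] contain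
    [p'], and those missing [q] contain [q']: together 2c', at most c. The rest contain [p] and [q]:
    3c. *)
Lemma hit2_star u p p' q q' W : uniq [:: u; p; p'; q; q'] -> stable F (~: W) ->
    p' \in W -> q' \in W -> deep F W [set p; u] -> deep F W [set q; u] ->
    N [set p; q] [set u] <= 3 * c ->
  hit2 [set p; p'] [set q; q'] <= 8 * c.
Proof.
rewrite /= !inE !negb_or andbT => /and4P[/and4P[up up' uq uq'] /and3P[pp' pq pq'] /andP[p'q p'q'] qq'].
move=> stF p'W q'W dp dq le3.
have t3 a b : a != b -> u != a -> u != b -> N [set u; a; b] set0 <= c.
  by move=> ab ua ub; apply: num_triple => //; rewrite -setUA cardsU1 cards2 ab !inE negb_or ua ub.
have h12 : N [set p'] [set p; u] + N [set q'] [set q; u] <= c.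
  apply: leq_trans c'_le; rewrite mul2n -addnn.
  by apply: leq_add; apply: (deep_pair_mem_leq stF); rewrite // eq_sym.
suff : hit2 [set p; p'] [set q; q'] <= N [set u; p; q] set0 + N [set u; p; q'] set0
    + N [set u; p'; q] set0 + N [set u; p'; q'] set0 + N [set p'] [set p; u]
    + N [set q'] [set q; u] + N [set p; q] [set u].
  move: (t3 p q pq up uq) (t3 p q' pq' up uq') (t3 p' q p'q up' uq) (t3 p' q' p'q' up' uq') h12 le3.
  by clear; olia.
rewrite /hit2 -sum1_card big_mkcond /= (eq_bigr (fun A => if A \in F then
    (~~ [disjoint A & [set p; p']] && ~~ [disjoint A & [set q; q']] : nat) else 0)); last first.
  by move=> A _; rewrite inE; case: (A \in F) => //=; case: ifP.
rewrite -big_mkcond !numE -!big_split /=; apply: leq_sum => A _; rewrite !numE.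
by case: (u \in A); case: (p \in A); case: (p' \in A); case: (q \in A); case: (q' \in A).
Qed.

Lemma card_set4 x y z t : uniq [:: x; y; z; t] -> #|[set x; y; z; t]| = 4.
Proof.
move=> ux; rewrite -[4]/(size [:: x; y; z; t]) -(elimT card_uniqP ux).
by apply: eq_card => w; rewrite !inE -!orbA.
Qed.

Section TwoPairs.

Variables W : {set 'I_n}.
Hypotheses (stF : stable F (~: W)) (deg : {in W, forall x, 2 * N [set x] set0 <= #|F|}).

(** A third vertex in [W] would contradict [triangle_deg]. Degrees are bounded on [W] only, because
    shifts off [W] preserve just the traces on [W]. *)
Lemma deep_pair_third p p' q q' : uniq [:: p; p'; q; q'] -> W = [set p; p'; q; q'] ->
    deep F W [set p; q] ->
  exists z, [/\ z \notin W, N set0 [set p; q] <= 2 * c, deep F W [set p; z] & deep F W [set q; z]].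
Proof.
move=> uW WE d; move: (uW); rewrite /= !inE !negb_or andbT => /and3P[/and3P[pp' pq pq'] /andP[p'q p'q'] qq'].
have pW : p \in W by rewrite WE !inE eqxx.
have qW : q \in W by rewrite WE !inE eqxx !orbT.
have cW4 : #|W| <= 4 by rewrite WE card_set4.
have cpq := deep_pair_leq stF pq d.
have cW : #|W :\: [set p; q]| <= 4 by apply: leq_trans cW4; apply: subset_leq_card; apply: subsetDl.
have Wn : #|W| + 2 <= n by apply: leq_trans n_ge8; rewrite (leq_add2r 2 _ 6) (leq_trans cW4).
have [z [zp zq dpz dqz]] := third_vertex stF pW qW pq cW Wn cpq (deg pW) (deg qW).
exists z; split=> //; apply/negP=> zW.
have pz : p != z by rewrite eq_sym.
have qz : q != z by rewrite eq_sym.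
by apply: (@triangle_deg p q z); rewrite ?deg // (deep_pair_leq stF).
Qed.

(** Otherwise [triangle_hit], with third vertex off [W], leaves at least |F| - 12c members avoiding
    [q] and [q'], which is more than half. *)
Lemma pair_not_deep p p' q q' : uniq [:: p; p'; q; q'] -> W = [set p; p'; q; q'] ->
    2 * N set0 [set q; q'] < #|F| -> ~ deep F W [set p; p'].
Proof.
move=> uW WE hq d; have uW' : uniq [:: p; q; p'; q'].
  move: uW; rewrite /= !inE !negb_or andbT => /and3P[/and3P[-> -> ->] /andP[p'q ->] ->].
  by rewrite [q == _]eq_sym p'q.
have WE' : W = [set p; q; p'; q'].
  by rewrite WE; apply/setP=> x; rewrite !inE; case: (x == p); case: (x == q); case: (x == p').
have [z [zW cpp' dpz dp'z]] := deep_pair_third uW' WE' d.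
have nez x : x \in W -> x != z by move=> xW; apply: contraNneq zW => <-.
have [pW p'W qW q'W] : [/\ p \in W, p' \in W, q \in W & q' \in W].
  by rewrite WE !inE !eqxx !orbT.
move: uW; rewrite /= !inE !negb_or andbT => /and3P[/and3P[pp' pq pq'] /andP[p'q p'q'] qq'].
have := @triangle_hit p p' z q q' pp' (nez _ pW) (nez _ p'W) _ _ cpp'.
rewrite !inE !negb_or [q == p]eq_sym pq [q == p']eq_sym p'q [q' == p]eq_sym pq' [q' == p']eq_sym p'q' !nez //.
move/(_ isT isT (deep_pair_leq stF (nez _ pW) dpz) (deep_pair_leq stF (nez _ p'W) dp'z)).
by move: hq F_ge c_gt0; clear; olia.
Qed.

(** The third vertex is the centre of a star. The degrees of [p] and [q] sum to at most |F|, so no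
    more members contain both than avoid both: at most 2c. *)
Lemma hit2_deep p p' q q' : uniq [:: p; p'; q; q'] -> W = [set p; p'; q; q'] ->
    deep F W [set p; q] -> hit2 [set p; p'] [set q; q'] <= 8 * c.
Proof.
move=> uW WE d; have [z [zW cpq dpz dqz]] := deep_pair_third uW WE d.
have [pW p'W qW q'W] : [/\ p \in W, p' \in W, q \in W & q' \in W].
  by rewrite WE !inE !eqxx !orbT.
apply: (@hit2_star z p p' q q' W) => //.
  rewrite cons_uniq uW andbT; apply: contra zW; rewrite !inE.
  by case/or4P=> /eqP->.
apply: leq_trans (numS F (subxx _) (sub0set _)) _.
have := num_total q; rewrite [N set0 [set q]](num_split F _ _ p) setU0.
move: (deg pW); rewrite [N [set p] set0](num_split F _ _ q) setU0 (setUC [set q]).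
by move: (deg qW) cpq; clear; olia.
Qed.

#[local] Opaque deep.

(** A deep pair across is settled by [hit2_deep]. Otherwise no pair inside [W] is deep, each given
    pair has a point that is deep together with [u], and [u] is the centre of the star. *)
Lemma hit2_leq p p' q q' : uniq [:: p; p'; q; q'] -> W = [set p; p'; q; q'] ->
    2 * N set0 [set p; p'] < #|F| -> 2 * N set0 [set q; q'] < #|F| ->
  hit2 [set p; p'] [set q; q'] <= 8 * c.
Proof.
move=> uW WE hp hq.
have [pW p'W qW q'W] : [/\ p \in W, p' \in W, q \in W & q' \in W].
  by rewrite WE !inE !eqxx !orbT.
have cW : #|W| = 4 by rewrite WE card_set4.
move: (uW); rewrite /= !inE !negb_or andbT => /and3P[/and3P[pp' pq pq'] /andP[p'q p'q'] qq'].
have WEp : W = [set p'; p; q; q'] by rewrite WE (setUC [set p]).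
have WEq : W = [set p; p'; q'; q] by rewrite WE -!setUA (setUC [set q]).
have WEpq : W = [set p'; p; q'; q] by rewrite WEq (setUC [set p]).
have uWp : uniq [:: p'; p; q; q'] by rewrite /= !inE !negb_or [p' == p]eq_sym pp' p'q p'q' pq pq' qq'.
have uWq : uniq [:: p; p'; q'; q] by rewrite /= !inE !negb_or [q' == q]eq_sym pp' p'q p'q' pq pq' qq'.
have uWpq : uniq [:: p'; p; q'; q].
  by rewrite /= !inE !negb_or [p' == p]eq_sym [q' == q]eq_sym pp' p'q p'q' pq pq' qq'.
have [|npq] := deep_dec F W [set p; q]; first exact: hit2_deep.
have [|np'q] := deep_dec F W [set p'; q].
  by move/(hit2_deep uWp WEp); rewrite (setUC [set p']).
have [|npq'] := deep_dec F W [set p; q'].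
  by move/(hit2_deep uWq WEq); rewrite (setUC [set q']).
have [|np'q'] := deep_dec F W [set p'; q'].
  by move/(hit2_deep uWpq WEpq); rewrite (setUC [set p']) (setUC [set q']).
have npp' := pair_not_deep uW WE hq.
have nqq' : ~ deep F W [set q; q'].
  apply: (@pair_not_deep q q' p p') => //.
    by rewrite /= !inE !negb_or ![q == _]eq_sym ![q' == _]eq_sym; rewrite eq_sym pq p'q pq' p'q' [q' == q]eq_sym qq' pp'.
  by rewrite WE; apply/setP=> x; rewrite !inE; case: (x == p); case: (x == p'); case: (x == q); case: (x == q').
have nd x y : x \in W -> y \in W -> x != y -> ~ deep F W [set x; y].
  rewrite {1 2}WE !inE -!orbA => /or4P[] /eqP-> /or4P[] /eqP-> xy;
    first [by rewrite eqxx in xy | assumption | rewrite setUC; assumption].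
have [|u fu] := @firstP _ (~: W).
  by rewrite -card_gt0 cardsCs setCK card_ord cW subn_gt0 (leq_trans _ n_ge8).
have uW' : u \notin W by case: fu; rewrite inE.
have neu x : x \in W -> x != u by move=> xW; apply: contraNneq uW' => <-.
have W1 : 1 < #|W| by rewrite cW.
have Wn : #|W| + 2 <= n by rewrite cW (leq_trans _ n_ge8).
have star x y : x \in W -> y \in W -> x != y -> 2 * N set0 [set x; y] < #|F| ->
    exists z, [/\ z \in [set x; y] & deep F W [set z; u]].
  move=> xW yW xy hxy.
  have [dx|ndx] := deep_dec F W [set x; u]; first by exists x; rewrite !inE eqxx.
  have [dy|ndy] := deep_dec F W [set y; u]; first by exists y; rewrite !inE eqxx orbT.
  have := @num_single _ _ _ uniF k_ge3 3 W x u set0 stF W1 Wn fu xW.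
  have -> : 'C(3, 2) = 3 by [].
  have c3 : #|W :\: (x |: set0)| <= 3.
    by rewrite setU0; move: cW; rewrite (cardsD1 x W) xW add1n => -[->].
  have n3 w : w \in W :\: (x |: set0) -> ~ deep F W [set x; w].
    by rewrite !inE orbF => /andP[wx wW]; apply: nd; rewrite // eq_sym.
  move=> /(_ n3 ndx c3) bx.
  have := @num_single _ _ _ uniF k_ge3 2 W y u [set x] stF W1 Wn fu yW.
  have -> : 'C(2, 2) = 1 by [].
  have c2 : #|W :\: (y |: [set x])| <= 2.
    move: c3; rewrite setU0 (cardsD1 y) !inE yW eq_sym xy add1n ltnS; apply: leq_trans.
    by apply/subset_leq_card/subsetP=> t; rewrite !inE negb_or -andbA.
  have n2 w : w \in W :\: (y |: [set x]) -> ~ deep F W [set y; w].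
    by rewrite !inE negb_or => /andP[/andP[wy _] wW]; apply: nd; rewrite // eq_sym.
  (* At most 12c + 8c members would meet [[set x; y]], yet more than half do, that is over 24c. *)
  move=> /(_ n2 ndy c2) by'; exfalso.
  move: (num_total x) hxy; rewrite [N set0 [set x]](num_split F _ _ y) setU0 (setUC [set y]).
  by move: bx by' F_ge; clear; olia.
have fin r r' s s' : uniq [:: r; r'; s; s'] -> W = [set r; r'; s; s'] ->
    deep F W [set r; u] -> deep F W [set s; u] -> hit2 [set r; r'] [set s; s'] <= 8 * c.
  move=> uR WR dr ds; have [rW r'W sW s'W] : [/\ r \in W, r' \in W, s \in W & s' \in W].
    by rewrite WR !inE !eqxx !orbT.
  have rs : r != s by move: uR; rewrite /= !inE !negb_or => /andP[/and3P[_ ->]].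
  apply: (@hit2_star u r r' s s' W) => //.
    rewrite cons_uniq uR andbT; apply: contra uW'; rewrite !inE.
    by case/or4P=> /eqP->.
  (* Avoiding [u] leaves only the two other points of [W], whence [3 * c]. *)
  apply: (@num_pair _ _ _ uniF k_ge3 2 W _ u) => //.
  - by rewrite subUset !sub1set rW sW.
  - by rewrite cards2 rs.
  - exact: nd.
  have : #|W :\: [set r; s]| <= 2.
    have : #|W| <= 4 by rewrite cW.
    by rewrite -(cardsID [set r; s] W) (setIidPr _) ?cards2 ?rs // subUset !sub1set rW.
  apply: leq_trans; apply/subset_leq_card/subsetP=> t; rewrite !inE.
  by case: (t == u); rewrite ?orbT //= !orbF.
have [z [zp dz]] := star p p' pW p'W pp' hp.
have [t [tq dt]] := star q q' qW q'W qq' hq.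
move: zp tq; rewrite !inE => /orP[] /eqP zE /orP[] /eqP tE; rewrite zE tE in dz dt *.
- exact: fin.
- by rewrite (setUC [set q]); apply: fin.
- by rewrite (setUC [set p]); apply: fin.
- by rewrite (setUC [set p]) (setUC [set q]); apply: fin.
Qed.

End TwoPairs.

End Structure.

(** * Shifting *)

Definition moved (n : nat) (F : {set {set 'I_n}}) (i j : 'I_n) (A : {set 'I_n}) : bool :=
  [&& j \in A, i \notin A & i |: (A :\ j) \notin F].

Definition shift1 (n : nat) (F : {set {set 'I_n}}) (i j : 'I_n) (A : {set 'I_n}) : {set 'I_n} :=
  if moved F i j A then i |: (A :\ j) else A.

Definition shift (n : nat) (F : {set {set 'I_n}}) (i j : 'I_n) : {set {set 'I_n}} :=
  shift1 F i j @: F.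

(** A potential that strictly drops under every shift that changes the family, so that shifting
    terminates. *)
Definition weight (n : nat) (F : {set {set 'I_n}}) : nat := \sum_(A in F) \sum_(x in A) x.

Section Shift.

Variables (n k : nat) (F : {set {set 'I_n}}) (i j : 'I_n).
Hypothesis lt_ij : i < j.
Implicit Types (A B : {set 'I_n}) (x : 'I_n).

Lemma mem_shift1 A x : x != i -> x != j -> (x \in shift1 F i j A) = (x \in A).
Proof. by rewrite /shift1 => xi xj; case: ifP => // _; rewrite !inE (negbTE xi) xj. Qed.

Lemma mem_shift1_sub A x : x != i -> x \in shift1 F i j A -> x \in A.
Proof. by rewrite /shift1 => xi; case: ifP => // _; rewrite !inE (negbTE xi) => /andP[]. Qed.

Lemma mem_shift1_target A : i \in shift1 F i j A -> (i \in A) || (j \in A).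
Proof. by rewrite /shift1; case: ifP => [/and3P[-> _ _]|_ ->//]; rewrite orbT. Qed.

Lemma shift1_inj : {in F &, injective (shift1 F i j)}.
Proof.
move=> A B AF BF; rewrite /shift1; case: ifP => [/and3P[jA iA AN]|_]; case: ifP => [/and3P[jB iB BN]|_] //.
- move=> eqAB; rewrite -(setD1K jA) -(setD1K jB); congr (_ |: _).
  by rewrite -[A :\ j](@setU1K _ i) ?eqAB ?setU1K // !inE ?(negbTE iA) ?(negbTE iB) andbF.
- by move=> eqAB; rewrite eqAB BF in AN.
- by move=> eqAB; rewrite -eqAB AF in BN.
Qed.

Lemma card_shift1 A : #|shift1 F i j A| = #|A|.
Proof.
rewrite /shift1; case: ifP => // /and3P[jA iA _].
by rewrite cardsU1 !inE (negbTE iA) andbF (cardsD1 j A) jA.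
Qed.

Lemma card_shift_pred (Q : pred {set 'I_n}) :
  #|[set B in shift F i j | Q B]| = #|[set A in F | Q (shift1 F i j A)]|.
Proof.
rewrite -[RHS](card_in_imset (f := shift1 F i j)); last first.
  by move=> A B; rewrite !inE => /andP[AF _] /andP[BF _]; apply: shift1_inj.
apply: eq_card => B; apply/idP/imsetP => [|[A]]; rewrite !inE.
  by case/andP=> /imsetP[A AF ->] QA; exists A; rewrite ?inE ?AF.
by case/andP=> AF QA ->; rewrite imset_f.
Qed.

Lemma card_shift : #|shift F i j| = #|F|.
Proof. exact: card_in_imset shift1_inj. Qed.

Lemma uniform_shift : uniform k F -> uniform k (shift F i j).
Proof. by move=> uniF _ /imsetP[A AF ->]; rewrite card_shift1 uniF. Qed.

Lemma intersecting_shift : intersecting F -> intersecting (shift F i j).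
Proof.
move=> intF; have half A B : A \in F -> B \in F -> moved F i j A -> ~~ moved F i j B ->
    (i |: A :\ j) :&: B != set0.
  move=> AF BF /and3P[jA iA _] NB; case: (boolP (i \in B)) => iB.
    by apply/set0Pn; exists i; rewrite !inE eqxx.
  (* If [B] contains [j] but not [i] and stays put, its exchange is already in [F]. Meeting [A] with
     that exchange gives a common point other than [i] and [j]. *)
  have [B' B'F B'B] : exists2 B', B' \in F & forall x, x \in A -> x \in B' -> x != j /\ x \in B.
    case: (boolP (j \in B)) => jB; last first.
      by exists B => // x _ xB; split=> //; apply: contraNneq jB => <-.
    exists (i |: B :\ j); first by move: NB; rewrite /moved jB iB negbK.
    move=> x xA; rewrite !inE; case: eqP => [xi|_ /andP[]//].
    by move: iA; rewrite -xi xA.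
  have /set0Pn[x] := intF A B' AF B'F; rewrite inE => /andP[xA /(B'B x xA)[xj xB]].
  by apply/set0Pn; exists x; rewrite !inE xj xA xB orbT.
move=> _ _ /imsetP[A AF ->] /imsetP[B BF ->]; rewrite /shift1.
case: ifP => mA; case: ifP => mB; last exact: intF.
- by apply/set0Pn; exists i; rewrite !inE eqxx.
- by apply: half; rewrite ?mB.
- by rewrite setIC; apply: half; rewrite ?mA.
Qed.

Lemma weight_shift A : A \in F -> moved F i j A -> weight (shift F i j) < weight F.
Proof.
move=> AF mA; rewrite /weight /shift big_imset /=; last exact: shift1_inj.
have lt_w B : moved F i j B -> \sum_(x in shift1 F i j B) x < \sum_(x in B) x.
  move=> mB; rewrite /shift1 mB; case/and3P: mB => jB iB _.
  rewrite big_setU1 /=; last by rewrite !inE (negbTE iB) andbF.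
  by rewrite (big_setD1 j jB) /= ltn_add2r.
rewrite (bigD1 A) // [X in _ < X](bigD1 A) //= -addSn; apply: leq_add; first exact: lt_w.
apply: leq_sum => B _; case: (boolP (moved F i j B)) => [/lt_w/ltnW//|/negbTE mB].
by rewrite /shift1 mB.
Qed.

End Shift.

(** This says only that the shift changes the family; that it breaks the degree bound is derived for
    a family of least weight. *)
Definition resistant (n : nat) (F : {set {set 'I_n}}) (i j : 'I_n) : bool :=
  (i < j) && [exists A in F, moved F i j A].

Lemma stable_not_resistant n (F : {set {set 'I_n}}) (D : {set 'I_n}) :
  {in D &, forall i j, ~~ resistant F i j} -> stable F D.
Proof.
move=> nr i j A iD jD lt_ij AF jA iA; apply: contraT => N.
have := nr i j iD jD; rewrite /resistant lt_ij => /existsPn/(_ A).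
by rewrite AF /moved jA iA N.
Qed.

(* Shifts off W do not change traces on W. *)
Lemma exists_stable n k (F : {set {set 'I_n}}) (W : {set 'I_n}) : intersecting F -> uniform k F ->
  exists G : {set {set 'I_n}}, [/\ intersecting G, uniform k G, stable G (~: W)
    & forall Q : pred {set 'I_n}, (forall A, Q A = Q (A :&: W)) ->
        #|[set A in G | Q A]| = #|[set A in F | Q A]|].
Proof.
have [m] := ubnP (weight F); elim: m F => // m IHm F wF intF uniF.
have [/existsP[i /existsP[j /and4P[iW jW lt_ij /existsP[A /andP[AF mA]]]]]|no] :=
  boolP [exists i, exists j, [&& i \in ~: W, j \in ~: W & resistant F i j]].
  have [|G [intG uniG stG eqG]] := IHm (shift F i j) _ (intersecting_shift intF) (uniform_shift uniF).
    by rewrite (leq_trans (weight_shift lt_ij AF mA)).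
  exists G; split=> // Q QW; rewrite eqG // card_shift_pred.
  apply: eq_card => B; rewrite !inE; congr (_ && _); rewrite QW [RHS]QW; congr (Q _).
  apply/setP=> x; rewrite !inE; case: (boolP (x \in W)) => xW; rewrite ?andbF // !andbT.
  rewrite !inE in iW jW.
  by apply: mem_shift1; [apply: contraNneq iW => <- | apply: contraNneq jW => <-].
exists F; split=> //; apply: stable_not_resistant => i j iW jW.
by move/existsPn/(_ i)/existsPn/(_ j): no; rewrite iW jW.
Qed.

(** A set can contain [i] after the shift only if it met [[set i; j]] before. *)
Lemma num_shift_target n (F : {set {set 'I_n}}) i j :
  num (shift F i j) [set i] set0 + num F set0 [set i; j] <= #|F|.
Proof.
rewrite /num card_shift_pred -(cardsID [set A : {set 'I_n} | [disjoint A & [set i; j]]] F) addnC.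
apply: leq_add; apply/subset_leq_card/subsetP=> A; rewrite !inE.
  by case/and3P=> -> _ ->.
by case/and3P=> -> + _; rewrite sub1set disjoint_set2r => /mem_shift1_target; case: (i \in A); case: (j \in A).
Qed.

Lemma num_shift_other n (F : {set {set 'I_n}}) i j x : x != i ->
  num (shift F i j) [set x] set0 <= num F [set x] set0.
Proof.
move=> xi; rewrite /num card_shift_pred; apply/subset_leq_card/subsetP=> A; rewrite !inE.
by case/and3P=> -> + _; rewrite !sub1set => /mem_shift1_sub->//; rewrite disjoint_set0r.
Qed.

(** * Numerical bounds and the minimal counterexample *)

Lemma binomial_bounds n k M : 3 <= k -> 2 * k <= n -> 48 * 'C(n - 3, k - 3) <= M -> M <= 'C(n, k) ->
  [/\ 8 <= n, 2 * (if 4 <= k then 'C(n - 3, k - 4) else 0) <= 'C(n - 3, k - 3) & 0 < 'C(n - 3, k - 3)].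
Proof.
move=> k3 le_kn le1 le2; have {M le1 le2} le := leq_trans le1 le2.
have [a ka] : exists a, k = a.+3 by exists (k - 3); lia.
have [b nb] : exists b, n = b.+3 by exists (n - 3); lia.
subst n k; rewrite !subSS !subn0 in le *.
have c0 : 0 < 'C(b, a) by rewrite bin_gt0; lia.
have h1 := mul_bin_diag b.+3 a.+2; have h2 := mul_bin_diag b.+2 a.+1.
have h3 := mul_bin_diag b.+1 a; rewrite /= in h1 h2 h3.
(* The ratio of ['C(n, k)] to ['C(n - 3, k - 3)] is n(n-1)(n-2) / (k(k-1)(k-2)). *)
have key : 48 * (a.+3 * (a.+2 * a.+1)) <= b.+3 * (b.+2 * b.+1).
  rewrite -(leq_pmul2r c0).
  move: (congr1 (muln (a.+2 * a.+1)) h1) (congr1 (muln (b.+3 * a.+1)) h2) (congr1 (muln (b.+3 * b.+2)) h3).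
  have := leq_mul (leqnn (a.+3 * a.+2 * a.+1)) le.
  clear; move: 'C(b.+3, a.+3) 'C(b.+2, a.+2) 'C(b.+1, a.+1) 'C(b, a) => x y z w; lia.
(* For [n] at most 7 the right side of [key] is at most 210, while the left is at least 288. *)
have b5 : 5 <= b.
  rewrite leqNgt; apply/negP => b4; have : b.+3 * (b.+2 * b.+1) <= 7 * (6 * 5) by rewrite !leq_mul.
  have : 48 * (3 * (2 * 1)) <= 48 * (a.+3 * (a.+2 * a.+1)) by rewrite leq_mul2l !leq_mul.
  by move: key; clear; lia.
split=> //; case: ifP => // a0; case: a a0 {k3 h1 h2 h3 le c0} le_kn key => // a _ le_kn key.
rewrite subn1 /=; have := mul_bin_left b a.
(* Here [k = a.+4]. If this failed, [n] would be below 3k and the right side of [key] at most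
   27(a+4)(a+3)(a+2), against the factor 48. *)
have le_ab : 2 * a.+1 <= b - a.
  rewrite leqNgt; apply/negP => lt; have b3 : b <= (3 * a).+1 by lia.
  have : b.+3 * (b.+2 * b.+1) <= 3 * a.+4 * (3 * a.+3 * (3 * a.+2)) by rewrite !leq_mul //; lia.
  by move: key; clear; nia.
move=> eq; rewrite -(@leq_pmul2l a.+1) // eq mulnCA mulnA leq_mul2r.
by rewrite (mulnC 2) mulnC le_ab orbT.
Qed.

(** A member that meets t of the three sets contributes 3 - t + t(t-1)/2 on the right, which is at
    least 2. *)
Lemma card_hits n (F : {set {set 'I_n}}) (P Q R : {set 'I_n}) :
  2 * #|F| <= num F set0 P + num F set0 Q + num F set0 R
    + (hit2 F P Q + hit2 F P R + hit2 F Q R).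
Proof.
have hitE S T : hit2 F S T = \sum_(A in F) (~~ [disjoint A & S] && ~~ [disjoint A & T]).
  rewrite /hit2 -sum1_card big_mkcond [RHS]big_mkcond; apply: eq_bigr => A _.
  by rewrite inE; case: (A \in F) => //=; case: ifP.
rewrite !num_sum !hitE -sum1_card -!big_split big_distrr /=; apply: leq_sum => A _.
by rewrite !sub0set; do 3!case: [disjoint A & _].
Qed.

Lemma no_half_degree_family n k (F : {set {set 'I_n}}) : 3 <= k -> 2 * k <= n ->
    intersecting F -> uniform k F -> 48 * 'C(n - 3, k - 3) <= #|F| ->
  ~ (forall x, 2 * num F [set x] set0 <= #|F|).
Proof.
move=> k3 le_kn intF uniF leF; have leC : #|F| <= 'C(n, k).
  rewrite -[n in 'C(n, _)]card_ord -card_draws; apply/subset_leq_card/subsetP=> A AF.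
  by rewrite inE uniF.
have [n8 c'_le c_gt0] := binomial_bounds k3 le_kn leF leC; move: leF.
have [m] := ubnP (weight F); elim: m F intF uniF {leC} => // m IHm F intF uniF wF leF deg.
(* If at least half of [F] avoided the pair, the shifted family would keep the degree bound at a
   smaller weight. *)
have res i j : resistant F i j -> 2 * num F set0 [set i; j] < #|F|.
  case/andP=> lt_ij /existsP[A /andP[AF mA]]; rewrite ltnNge; apply/negP => le_num.
  apply: (IHm (shift F i j) (intersecting_shift intF) (uniform_shift uniF)); rewrite ?card_shift //.
    exact: leq_trans (weight_shift lt_ij AF mA) _.
  move=> x; case: (eqVneq x i) => [->|/num_shift_other le_x]; last first.
    by apply: leq_trans (deg x); rewrite leq_mul2l le_x.
  by have := num_shift_target F i j; move: le_num; clear; olia.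
have grow (W : {set 'I_n}) : 1 < #|W| -> #|W| <= 4 ->
    exists i j, [/\ i \notin W, j \notin W, i != j & resistant F i j].
  move=> W1 W4; have [/existsP[i /existsP[j /and3P[iW jW r]]]|no] :=
    boolP [exists i, exists j, [&& i \notin W, j \notin W & resistant F i j]].
    by exists i, j; split=> //; case/andP: r => + _; apply: contraTneq => ->; rewrite ltnn.
  exfalso; apply: (no_half_degrees intF uniF k3 n8 leF c'_le c_gt0 _ W1 W4 deg).
  apply: stable_not_resistant => i j; rewrite !inE => iW jW.
  by move/existsPn/(_ i)/existsPn/(_ j): no; rewrite iW jW.
have W2 (x y : 'I_n) : x != y -> 1 < #|[set x; y]| <= 4 by move=> xy; rewrite cards2 xy.
have [i [j [_ _ ij rij]]] : exists i j, [/\ i \notin (set0 : {set 'I_n}), j \notin (set0 : {set 'I_n}), i != j & resistant F i j].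
  (* [grow] needs two points to start from; this choice is arbitrary and dropped once a first pair
     is found. *)
  have /andP[c1 c4] := W2 (Ordinal (leq_trans (isT : 0 < 8) n8)) (Ordinal (leq_trans (isT : 1 < 8) n8)) isT.
  by have [i [j [_ _ ij r]]] := grow _ c1 c4; exists i, j; rewrite !inE.
have /andP[c1 c4] := W2 i j ij.
have [p [q [pW qW pq rpq]]] := grow _ c1 c4.
have uW : uniq [:: i; j; p; q].
  move: pW qW; rewrite /= !inE !negb_or ij pq !andbT => /andP[pi pj] /andP[qi qj].
  by rewrite ![i == _]eq_sym ![j == _]eq_sym; apply/and3P; split; rewrite ?pi ?qi ?pj ?qj // eq_sym.
have cW := card_set4 uW.
have [r [s [rW sW rs rrs]]] : exists r s, [/\ r \notin [set i; j; p; q], s \notin [set i; j; p; q], r != s & resistant F r s].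
  by apply: grow; rewrite cW.
have hit (i1 j1 i2 j2 : 'I_n) : uniq [:: i1; j1; i2; j2] -> resistant F i1 j1 -> resistant F i2 j2 ->
    hit2 F [set i1; j1] [set i2; j2] <= 8 * 'C(n - 3, k - 3).
  move=> u4 /res r1 /res r2; pose W := [set i1; j1; i2; j2].
  (* All counts that enter [hit2_leq] depend only on traces on [W], so they agree for [G] and
     [F]. *)
  have [G [intG uniG stG eqG]] := exists_stable W intF uniF.
  have dW (X A : {set 'I_n}) : X \subset W -> [disjoint A & X] = [disjoint A :&: W & X].
    by move=> sX; rewrite -!setI_eq0 -setIA (setIidPr sX).
  have numG (X Y : {set 'I_n}) : X \subset W -> Y \subset W -> num G X Y = num F X Y.
    by move=> sX sY; rewrite /num eqG // => A; rewrite subsetI sX andbT -dW.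
  have cG : #|G| = #|F|.
    have := eqG predT (fun=> erefl); rewrite (eq_card (B := G)) => [|A]; last by rewrite inE andbT.
    by move=> ->; apply: eq_card => A; rewrite inE andbT.
  have [i1W j1W i2W j2W] : [/\ i1 \in W, j1 \in W, i2 \in W & j2 \in W] by rewrite !inE !eqxx !orbT.
  have s1 : [set i1; j1] \subset W by rewrite subUset !sub1set i1W.
  have s2 : [set i2; j2] \subset W by rewrite subUset !sub1set i2W.
  have -> : hit2 F [set i1; j1] [set i2; j2] = hit2 G [set i1; j1] [set i2; j2].
    by rewrite /hit2 eqG // => A; rewrite -!dW.
  apply: (hit2_leq intG uniG k3 n8 _ c'_le c_gt0 stG _ u4 (erefl W)); rewrite ?cG ?numG ?sub0set //.
  by move=> x xW; rewrite numG ?sub0set ?sub1set // cG.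
move: rW sW; rewrite !inE !negb_or -!andbA => /and4P[ri rj rp rq] /and4P[si sj sp sq].
have h1 := hit _ _ _ _ uW rij rpq.
have h2 : hit2 F [set i; j] [set r; s] <= 8 * 'C(n - 3, k - 3).
  apply: hit => //; rewrite /= !inE !negb_or ij rs !andbT ![i == _]eq_sym ![j == _]eq_sym.
  by rewrite ri rj si sj.
have h3 : hit2 F [set p; q] [set r; s] <= 8 * 'C(n - 3, k - 3).
  apply: hit => //; rewrite /= !inE !negb_or pq rs !andbT ![p == _]eq_sym ![q == _]eq_sym.
  by rewrite rp rq sp sq.
(* Each pair is avoided by fewer than |F|/2 members, so 2|F| < 3|F|/2 + 24c. *)
move: (card_hits F [set i; j] [set p; q] [set r; s]) (res _ _ rij) (res _ _ rpq) (res _ _ rrs) h1 h2 h3 leF.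
by clear; olia.
Qed.

(** Every member meets [A], so the degrees of its points sum to at least |F| plus the number of
    members containing [A], which is positive. For [k = 1] the two points coincide. *)
Lemma no_half_degree_graph n k (F : {set {set 'I_n}}) : k <= 2 -> intersecting F ->
  uniform k F -> F != set0 -> ~ (forall x, 2 * num F [set x] set0 <= #|F|).
Proof.
move=> k2 intF uniF /set0Pn[A AF] deg.
have [x [y AE]] : exists x y, A = [set x; y].
  move: (uniF A AF) k2; case: k {uniF} => [|[|[|k]]] // cA _.
  - by have := intF A A AF AF; rewrite setIid -cards_eq0 cA.
  - by move/eqP/cards1P: cA => [x ->]; exists x, x; rewrite setUid.
  by move/eqP/cards2P: cA => [x [y [_ ->]]]; exists x, y.
have : 0 < num F [set x; y] set0.
  by rewrite card_gt0; apply/set0Pn; exists A; rewrite inE AF AE subxx disjoint_set0r.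
have : #|F| + num F [set x; y] set0 <= num F [set x] set0 + num F [set y] set0.
  rewrite !num_sum -sum1_card -!big_split /=; apply: leq_sum => B BF; rewrite !numE.
  have /set0Pn[z] := intF A B AF BF; rewrite AE !inE => /andP[/orP[]/eqP-> ->];
    by case: (_ \in _).
by move: (deg x) (deg y); olia.
Qed.

Theorem mainTheorem2 (n k : nat) (F : {set {set 'I_n}}) :
  2 * k <= n ->
  uniform k F ->
  F != set0 ->
  intersecting F ->
  48 * binom_n3_k3 n k <= #|F| ->
  (1 / 2 < rho F)%R.
Proof.
move=> le_kn uniF F0 intF leF.
have M0 : 0 < #|F| by rewrite card_gt0.
have [/existsP[x dx]|/existsPn deg] := boolP [exists x, #|F| < 2 * num F [set x] set0]; last first.
  exfalso; have {}deg x : 2 * num F [set x] set0 <= #|F| by rewrite leqNgt.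
  (* [binom_n3_k3] is 0 for [k <= 2]; that range is settled from a single member, the rest by
     shifting. *)
  case: (leqP k 2) => [k2|k3]; first exact: (no_half_degree_graph k2 intF uniF F0 deg).
  by move: leF; rewrite /binom_n3_k3 k3 => leF; apply: (no_half_degree_family k3 le_kn intF uniF leF deg).
rewrite /rho ltr_pdivlMr ?ltr0n // mulrAC mul1r ltr_pdivrMr ?ltr0n // -natrM ltr_nat.
apply: (leq_trans dx); rewrite mulnC leq_mul2r /=.
apply: leq_trans (leq_bigmax x); apply/subset_leq_card/subsetP=> A.
by rewrite !inE sub1set => /and3P[-> ->].
Qed.
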